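(* Let $K$ be a finite simplicial complex and $f: K \to \mathbb{R}$ an excellent discrete Morse function, and let $\sigma^{(q)}$ be a critical simplex of $f$ of dimension $q$. Then $\sigma$ belongs to exactly one of the following three kinds of persistence pairs (with respect to the sub-level filtration of $f$): (1) a $q$-dimensional persistence pair $(\sigma^{(q)}, \tau^{(q+1)})$ for some $(q+1)$-simplex $\tau$; (2) a $(q-1)$-dimensional persistence pair $(\alpha^{(q-1)}, \sigma^{(q)})$ for some $(q-1)$-simplex $\alpha$; (3) a $q$-dimensional persistence pair with infinity $(\sigma^{(q)}, \infty)$.
   Context: A discrete Morse function on a simplicial complex $K$ is a function $f: K \to \mathbb{R}$ on the set of simplices such that for every $p$-simplex $\sigma$: at most one $(p+1)$-simplex $\tau \succ \sigma$ has $f(\tau) \le f(\sigma)$, and at most one $(p-1)$-face $v \prec \sigma$ has $f(\sigma) \le f(v)$. A simplex is critical if there is no such $\tau$ and no such $v$. $f$ is excellent if all critical values are distinct. The superscript $(p)$ indicates dimension $p$. For $c\in\mathbb{R}$, $K(c)$ is the subcomplex of all simplices $\sigma$ with $f(\sigma)\le c$ together with their faces. Let $c_1<\dots<c_n$ be the values of $f$, giving the filtration $K(c_1)\subset\cdots\subset K(c_n)=K$. Homology is simplicial homology with coefficients in a finite field $\mathbb{F}$. A homology class $[h] \in H_*(K(c_i))$ is born at $c_i$ if it is not in the image of $H_*(K(c_{i-1}))$; it persists at $c_i$ if its image in $H_*(K(c_{i+1}))$ is nonzero, and dies there otherwise; if $f(\sigma) = c_i$ one also says it is born / dies at $\sigma$.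 The elder rule is applied: when classes merge, the death is assigned to the youngest class. A pair $(\sigma,\tau)$ is a persistence pair if some homology class is born at $\sigma$ and dies at $\tau$; if it never dies, $\sigma$ is paired with infinity, written $(\sigma,\infty)$. The dimension of a persistence pair is the dimension of its birth simplex. *)

(* Defs.v *)
From mathcomp Require Import all_boot all_order all_algebra.
From mathcomp Require Import reals.

Set Implicit Arguments.
Unset Strict Implicit.
Unset Printing Implicit Defensive.

Import Order.TTheory GRing.Theory Num.Theory.
Local Open Scope ring_scope.

(* A simplex is the finite set of its vertices. The empty set is not a simplex,
   so the homology below is not reduced. *)
Definition simplicial_complex (V : finType) (K : {set {set V}}) : Prop :=
  set0 \notin K /\
  (forall s t : {set V}, s \in K -> t \subset s -> t != set0 -> t \in K).

Definition simplex_dim (V : finType) (s : {set V}) : nat := #|s|.-1.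

Definition facet (V : finType) (v s : {set V}) : bool :=
  (v \subset s) && (#|s| == #|v|.+1).

Section DiscreteMorse.
Variables (R : realType) (V : finType) (K : {set {set V}}) (f : {set V} -> R).

Definition upper_exceptions (s : {set V}) : {set {set V}} :=
  [set t in K | facet s t & f t <= f s].

Definition lower_exceptions (s : {set V}) : {set {set V}} :=
  [set v in K | facet v s & f s <= f v].

Definition discrete_morse : Prop :=
  forall s : {set V}, s \in K ->
    (#|upper_exceptions s| <= 1)%N /\ (#|lower_exceptions s| <= 1)%N.

Definition critical (s : {set V}) : Prop :=
  [/\ s \in K, upper_exceptions s = set0 & lower_exceptions s = set0].

Definition excellent : Prop :=
  forall s t : {set V}, critical s -> critical t -> f s = f t -> s = t.

Definition sublevel (c : R) : {set {set V}} :=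
  [set t in K | [exists s in K, (f s <= c) && (t \subset s)]].

(* c_1 < ... < c_n, stored from position 0. *)
Definition values : seq R := sort <=%R (undup [seq f s | s in K]).

(* [filtration i] is K(c_i) for 1 <= i <= n, with K(c_0) empty. *)
Definition filtration (i : nat) : {set {set V}} :=
  if i is i'.+1 then sublevel (nth 0 values i') else set0.

(* f s = c_i with 1 <= i <= n. *)
Definition appears_at (s : {set V}) (i : nat) : Prop :=
  [/\ (0 < i)%N, (i <= size values)%N & nth 0 values i.-1 = f s].

End DiscreteMorse.

Section Homology.
Variables (F : finFieldType) (V : finType).

Definition chain := {ffun {set V} -> F}.

Definition chains (p : nat) (L : {set {set V}}) : {set chain} :=
  [set x : chain | [forall s, (x s != 0) ==> (s \in L) && (#|s| == p.+1)]].

(* Simplices are oriented by the enumeration order of V: if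
   enum s = [:: v_0; ...; v_p], the face omitting v_i has sign (-1)^i in the
   boundary of s. The boundary of a vertex is 0. *)
Definition boundary (x : chain) : chain :=
  [ffun t : {set V} =>
     if t == set0 then 0
     else \sum_(s : {set V}) \sum_(v in s | s :\ v == t)
            (-1) ^+ index v (enum s) * x s].

Definition cycles (p : nat) (L : {set {set V}}) : {set chain} :=
  [set z in chains p L | boundary z == 0].

Definition boundaries (p : nat) (L : {set {set V}}) : {set chain} :=
  [set boundary x | x in chains p.+1 L].

Definition hclass (p : nat) (L : {set {set V}}) (z : chain) : {set chain} :=
  [set z + b | b in boundaries p L].

(* H_p(L) is the set of cosets of the p-boundaries in the p-cycles. *)
Definition homology (p : nat) (L : {set {set V}}) : {set {set chain}} :=
  [set hclass p L z | z in cycles p L].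

(* The map H_p(L0) -> H_p(L) induced by an inclusion of L0 in L, sending
   z + B_p(L0) to z + B_p(L). *)
Definition induced (p : nat) (L : {set {set V}}) (h : {set chain}) :
    {set chain} :=
  [set z + b | z : chain in h, b : chain in boundaries p L].

End Homology.

Section Persistence.
Variables (R : realType) (F : finFieldType) (V : finType).
Variables (K : {set {set V}}) (f : {set V} -> R).

(* The image of H_p(K(c_i)) in H_p(K(c_k)), for i <= k. *)
Definition image_homology (p i k : nat) : {set {set chain F V}} :=
  [set induced p (filtration K f k) g | g in homology F p (filtration K f i)].

Definition born_at (p i : nat) (h : {set chain F V}) : Prop :=
  h \in homology F p (filtration K f i) /\ h \notin image_homology p i.-1 i.

(* Elder rule: a class h born at c_i dies at c_j when, in passing from
   K(c_(j-1)) to K(c_j), it becomes equal to the image of an older class, that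
   is of a class of K(c_(i-1)). As 0 is such a class, this covers the case
   where the image of h becomes 0. *)
Definition dies_at (p i j : nat) (h : {set chain F V}) : Prop :=
  [/\ (i < j)%N,
      induced p (filtration K f j.-1) h \notin image_homology p i.-1 j.-1
    & induced p (filtration K f j) h \in image_homology p i.-1 j].

Definition persistence_pair (s t : {set V}) : Prop :=
  s \in K /\ t \in K /\
  exists (p i j : nat) (h : {set chain F V}),
    [/\ appears_at K f s i, appears_at K f t j, born_at p i h
      & dies_at p i j h].

Definition persistence_pair_infty (s : {set V}) : Prop :=
  s \in K /\
  exists (p i : nat) (h : {set chain F V}),
    [/\ appears_at K f s i, born_at p i h
      & forall j : nat, (j <= size (values K f))%N -> ~ dies_at p i j h].

End Persistence.

Definition exactly_one_of_three (A B C : Prop) : Prop :=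
  [\/ A, B | C] /\ [/\ ~ (A /\ B), ~ (A /\ C) & ~ (B /\ C)].

(* Main.v *)
(* Let c be the value of a critical simplex sigma, K(c) the sublevel set at c
   and L0 the one just before it. The simplices of K(c) outside L0 are sigma
   and gradient pairs (t, u) with f u = c <= f t. The uniqueness conditions
   on f imply that all the facets of sigma and t, and all those of u but t,
   lie in L0, and that sigma has no cofacet in K(c). Hence the relative
   complex of (K(c), L0) splits as the span of sigma, with zero boundary,
   plus copies of an isomorphism F -> F, and its homology is spanned by
   sigma. So either some q-cycle z of K(c) has a nonzero coefficient at
   sigma, and the classes born at sigma are those with such a
   representative, or the boundary of sigma is not a boundary in L0 and a
   (q-1)-class dies. In the first case a class born at sigma dies, if ever,
   at a critical (q+1)-simplex; in the second case the class of the boundary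
   of sigma was born at a critical (q-1)-simplex. The cases exclude each
   other since subtracting a multiple of z from a q-chain bounding a cycle
   of L0 removes sigma from it; and any two classes born at sigma agree, up
   to a scalar, modulo older classes, so that either all or none of them
   eventually die. *)
Require Import Defs.
From HB Require Import structures.
From mathcomp Require Import all_boot all_order all_algebra.
From mathcomp Require Import reals.

Set Implicit Arguments.
Unset Strict Implicit.
Unset Printing Implicit Defensive.

Import Order.TTheory GRing.Theory Num.Theory.
Local Open Scope ring_scope.

(** * Signed incidences and the vanishing of the double boundary *)

Section Boundary.
Variables (F : finFieldType) (V : finType).
Implicit Types (s t : {set V}) (x y : chain F V).

Definition incidence t s : F :=
  \sum_(v in s | s :\ v == t) (-1) ^+ index v (enum s).

Lemma boundaryE x t :
  t != set0 -> boundary x t = \sum_s incidence t s * x s.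
Proof.
move=> t0; rewrite ffunE (negPf t0); apply: eq_bigr => s _.
by rewrite mulr_suml.
Qed.

Lemma boundary_set0 x : boundary x set0 = 0.
Proof. by rewrite ffunE eqxx. Qed.

Lemma facetP t s :
  reflect (exists2 v, v \notin t & s = v |: t) (facet t s).
Proof.
apply: (iffP andP) => [[ts /eqP cs]|[v vt ->]]; last first.
  by rewrite subsetUr cardsU1 vt.
have /cards1P[v sv] : #|s :\: t| == 1%N.
  by rewrite cardsD (setIidPr ts) cs subSnn.
have: v \in s :\: t by rewrite sv set11.
rewrite inE => /andP[vt _]; exists v => //.
by rewrite -[LHS](setID s t) (setIidPr ts) sv setUC.
Qed.

Lemma incidence_cofacet v t :
  v \notin t -> incidence t (v |: t) = (-1) ^+ index v (enum (v |: t)).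
Proof.
move=> vt; rewrite /incidence (big_pred1 v) // => w; apply/andP/eqP => [|->].
  move=> [wvt /eqP e]; apply/eqP; apply: contraTT vt => wv.
  by rewrite -e !inE eq_sym wv eqxx.
by rewrite setU11 setU1K.
Qed.

Lemma incidence_neq0 t s : incidence t s != 0 -> facet t s.
Proof.
apply: contraR => nf; rewrite /incidence big1 // => v /andP[vs /eqP e].
by case/facetP: nf; exists v; rewrite -e ?setD11 ?setD1K.
Qed.

Lemma incidence_sqr t s : facet t s -> incidence t s * incidence t s = 1.
Proof. by case/facetP=> v vt ->; rewrite incidence_cofacet // -expr2 sqrr_sign. Qed.

Lemma boundary_is_zmod_morphism : zmod_morphism (@boundary F V).
Proof.
move=> x y; apply/ffunP => t; rewrite !ffunE.
case: ifP => _; first by rewrite subr0.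
rewrite -sumrB; apply: eq_bigr => s _ /=.
by rewrite -sumrB; apply: eq_bigr => v _ /=; rewrite !ffunE mulrBr.
Qed.

HB.instance Definition _ :=
  GRing.isZmodMorphism.Build (chain F V) (chain F V) (@boundary F V)
    boundary_is_zmod_morphism.

Definition scale_chain (k : F) x : chain F V := [ffun s => k * x s].

Lemma boundary_scale k x :
  boundary (scale_chain k x) = scale_chain k (boundary x).
Proof.
apply/ffunP => t; rewrite !ffunE; case: ifP => _; first by rewrite mulr0.
rewrite mulr_sumr; apply: eq_bigr => s _; rewrite mulr_sumr.
by apply: eq_bigr => v _; rewrite ffunE mulrCA.
Qed.

(** For [v] outside [t] this is the position that [v] would take in [t], so that signs can be
    written before a vertex is inserted. *)
Let before v t := count [in t] (take (index v (enum V)) (enum V)).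

Lemma index_enum_set v t : v \in t -> index v (enum t) = before v t.
Proof.
move=> vt; rewrite /before enumT [enum _]/enum_mem -enumT.
have : v \in enum V by rewrite mem_enum.
elim: (enum V) => //= a l IH; rewrite inE.
case: (eqVneq v a) => [<-|av]; first by rewrite vt /= eqxx.
move=> /= /IH {}IH.
by case: ifP => _; rewrite /= ?[a == v]eq_sym ?(negPf av) IH ?add0n ?add1n.
Qed.

Lemma before_setU1 v w t : w \notin t ->
  before v (w |: t) = ((index w (enum V) < index v (enum V)) + before v t)%N.
Proof.
move=> wt; rewrite /before.
have -> : (index w (enum V) < index v (enum V))%N =
          (w \in take (index v (enum V)) (enum V)).
  by rewrite in_take // mem_enum.
rewrite -count_uniq_mem ?take_uniq ?enum_uniq // -count_predUI.
rewrite [X in (_ + X)%N](eq_count (a2 := pred0)) ?count_pred0 ?addn0.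
  by apply: eq_count => a; rewrite !inE.
by move=> a; rewrite /= ; case: eqVneq => //= ->; rewrite (negPf wt).
Qed.

(** The cofacets of [t] correspond to the vertices outside [t]; with this indexing a double boundary
    runs over ordered pairs of vertices. *)
Lemma boundary_cofacets x t : t != set0 ->
  boundary x t = \sum_(v | v \notin t) (-1) ^+ before v t * x (v |: t).
Proof.
move=> t0; rewrite boundaryE //.
have inj : {in [pred v | v \notin t] &, injective (fun v => v |: t)}.
  move=> v w vt wt e; apply/eqP; apply: contraTT vt => vw.
  have := setU11 v t; rewrite e !inE (negPf vw) /= => ->; by [].
rewrite (bigID [in [set v |: t | v in [pred v | v \notin t]]]) /=.
rewrite [X in _ + X]big1 ?addr0 => [|s nf].
  rewrite big_imset //=; apply: eq_bigr => v vt.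
  rewrite incidence_cofacet // index_enum_set ?setU11 // before_setU1 //.
  by rewrite ltnn.
have [->|] := eqVneq (incidence t s) 0; first by rewrite mul0r.
case/incidence_neq0/facetP=> v vt e; case/imsetP: nf; by exists v.
Qed.

Lemma boundary_boundary x : boundary (boundary x) = 0.
Proof.
apply/ffunP => t; rewrite [RHS]ffunE.
have [->|t0] := eqVneq t set0; first exact: boundary_set0.
rewrite boundary_cofacets //.
pose r v := index v (enum V).
pose G v w : F :=
  (-1) ^+ before v t * ((-1) ^+ before w t * x (w |: (v |: t))).
have Gsym v w : G v w = G w v by rewrite /G mulrCA setUCA.
pose P v w := [&& v \notin t, w \notin t & r v < r w]%N.
(* [G] is symmetric, but by [before_setU1] inserting [v] moves [w] by one place exactly when [v]
   comes first. Hence the two orders of a pair of vertices contribute opposite signs. *)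
transitivity (\sum_v \sum_(w | P v w) - G v w + \sum_v \sum_(w | P w v) G v w).
  rewrite -big_split big_mkcond /=; apply: eq_bigr => v _.
  have [vt|vt] := boolP (v \in t).
    by rewrite !big_pred0 ?addr0 // => w; rewrite /P vt ?andbF.
  rewrite boundary_cofacets; last by apply/set0Pn; exists v; rewrite setU11.
  rewrite mulr_sumr (bigID (fun w => r v < r w)%N) /=; congr (_ + _).
    apply: eq_big => [w|w].
      rewrite /P vt !inE negb_or; case: eqVneq => //= ->.
      by rewrite ltnn andbF.
    case/andP=> _ vw; rewrite before_setU1 // -/(r _) -/(r _) vw.
    by rewrite add1n exprS mulN1r mulNr mulrN.
  apply: eq_big => [w|w].
    rewrite /P vt !inE negb_or /= -leqNgt leq_eqVlt; case: eqVneq => //= [->|wv].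
      by rewrite ltnn andbF.
    case: eqP => //= e; case: (negP wv); apply/eqP.
    by apply: (@index_inj _ v (enum V) w v _ _ e); rewrite mem_enum.
  by case/andP=> _ vw; rewrite before_setU1 // -/(r _) -/(r _) (negPf vw).
rewrite [X in _ + X](exchange_big_dep xpredT) //= -big_split big1 //= => v _.
rewrite -big_split big1 //= => w _; by rewrite Gsym addNr.
Qed.

End Boundary.

(** * Chains, cycles, boundaries and homology cosets *)

Section Chains.
Variables (F : finFieldType) (V : finType).
Implicit Types (L : {set {set V}}) (x y z b : chain F V).

Lemma chainsP p L x :
  reflect (forall s, x s != 0 -> s \in L /\ #|s| = p.+1) (x \in chains F p L).
Proof.
rewrite inE; apply: (iffP forallP) => [H s xs|H s].
  by have := H s; rewrite xs => /andP[-> /eqP].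
by apply/implyP => /H[-> ->] /=.
Qed.

Lemma chains0 p L : 0 \in chains F p L.
Proof. by apply/chainsP => s; rewrite ffunE eqxx. Qed.

Lemma chainsB p L x y :
  x \in chains F p L -> y \in chains F p L -> x - y \in chains F p L.
Proof.
move=> /chainsP xL /chainsP yL; apply/chainsP => s; rewrite !ffunE.
have [x0|/xL //] := eqVneq (x s) 0; have [y0|/yL //] := eqVneq (y s) 0.
by rewrite x0 y0 subrr eqxx.
Qed.

Lemma scale_chains p L k x :
  x \in chains F p L -> scale_chain k x \in chains F p L.
Proof.
move/chainsP=> xL; apply/chainsP => s; rewrite ffunE mulf_eq0 negb_or.
by case/andP=> _ /xL.
Qed.

Lemma chains_subset p (L0 L : {set {set V}}) x :
  L0 \subset L -> x \in chains F p L0 -> x \in chains F p L.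
Proof. by move=> /subsetP sL /chainsP xL; apply/chainsP => s /xL[/sL]. Qed.

Lemma boundary_support x t : boundary x t != 0 ->
  t != set0 /\ exists2 s, facet t s & x s != 0.
Proof.
have [->|t0] := eqVneq t set0; first by rewrite boundary_set0 eqxx.
rewrite boundaryE // => /eqP nz; split=> //; apply/exists_inP.
apply: contra_notT nz => /exists_inPn none; apply: big1 => s _.
have [->|/incidence_neq0/none] := eqVneq (incidence F t s) 0; first by rewrite mul0r.
by rewrite negbK => /eqP->; rewrite mulr0.
Qed.

Lemma chains_boundary p L x : simplicial_complex L ->
  x \in chains F p.+1 L -> boundary x \in chains F p L.
Proof.
move=> [_ clL] /chainsP xL; apply/chainsP => t /boundary_support[t0 [s ts xs]].
have [sL cs] := xL _ xs; case/andP: ts => sts /eqP; rewrite cs => -[<-].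
by split=> //; apply: clL sts t0.
Qed.

Lemma boundaries0 p L : 0 \in boundaries F p L.
Proof. by apply/imsetP; exists 0; rewrite ?chains0 ?raddf0. Qed.

Lemma boundariesB p L x y : x \in boundaries F p L -> y \in boundaries F p L ->
  x - y \in boundaries F p L.
Proof.
move=> /imsetP[a aL ->] /imsetP[b bL ->].
by apply/imsetP; exists (a - b); rewrite ?chainsB ?raddfB.
Qed.

Lemma boundariesD p L x y : x \in boundaries F p L -> y \in boundaries F p L ->
  x + y \in boundaries F p L.
Proof.
move=> xB yB; rewrite -[y]opprK boundariesB // -sub0r boundariesB //.
exact: boundaries0.
Qed.

Lemma boundaries_subset p (L0 L : {set {set V}}) x :
  L0 \subset L -> x \in boundaries F p L0 -> x \in boundaries F p L.
Proof.
move=> sL /imsetP[y yL ->]; apply/imsetP; exists y => //.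
exact: chains_subset yL.
Qed.

Lemma cyclesP p L z :
  reflect (z \in chains F p L /\ boundary z = 0) (z \in cycles F p L).
Proof.
by rewrite [X in reflect _ X]inE; apply: (iffP andP) => -[zL /eqP].
Qed.

Lemma scale_chainB k x y :
  scale_chain k (x - y) = scale_chain k x - scale_chain k y.
Proof. by apply/ffunP => s; rewrite !ffunE mulrBr. Qed.

Lemma chains_sub_scale p L k x y : x \in chains F p L -> y \in chains F p L ->
  x - scale_chain k y \in chains F p L.
Proof. by move=> xL yL; rewrite chainsB // scale_chains. Qed.

Lemma cycles_sub_scale p L k x y : x \in cycles F p L -> y \in cycles F p L ->
  x - scale_chain k y \in cycles F p L.
Proof.
move=> /cyclesP[xL dx] /cyclesP[yL dy]; apply/cyclesP.
rewrite chains_sub_scale // raddfB /= boundary_scale dx dy sub0r; split=> //.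
by apply/ffunP => s; rewrite !ffunE mulr0 oppr0.
Qed.

Lemma boundaries_sub_scale p L k x y : x \in boundaries F p L ->
  y \in boundaries F p L -> x - scale_chain k y \in boundaries F p L.
Proof.
move=> xL /imsetP[b bL ->]; rewrite boundariesB // -boundary_scale.
by rewrite imset_f // scale_chains.
Qed.

Lemma mem_hclass p L x z : (x \in hclass p L z) = (x - z \in boundaries F p L).
Proof.
apply/imsetP/idP => [[b bL ->]|xz]; first by rewrite addrC addKr.
by exists (x - z); rewrite // addrC subrK.
Qed.

Lemma hclass_eq p L x z :
  (hclass p L x == hclass p L z) = (x - z \in boundaries F p L).
Proof.
apply/eqP/idP => [e|xz]; first by rewrite -mem_hclass -e mem_hclass subrr boundaries0.
apply/setP => y; rewrite !mem_hclass; apply/idP/idP => yB.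
  by rewrite -[y - z](subrKA x) boundariesD.
have -> : y - x = (y - z) - (x - z) by rewrite opprB addrA subrK.
exact: boundariesB.
Qed.

Lemma induced_hclass p (L0 L : {set {set V}}) z : L0 \subset L ->
  induced p L (hclass p L0 z) = hclass p L z.
Proof.
move=> sL; apply/setP => x; rewrite mem_hclass; apply/imset2P/idP.
  move=> [y b]; rewrite mem_hclass => /(boundaries_subset sL) yz bL ->.
  by rewrite addrAC boundariesD.
move=> xz; exists z (x - z) => //; first by rewrite mem_hclass subrr boundaries0.
by rewrite addrC subrK.
Qed.

End Chains.

(** * Consequences of the Morse conditions for faces and sublevel sets *)

Section MorseCombinatorics.
Variables (R : realType) (V : finType) (K : {set {set V}}) (f : {set V} -> R).
Hypotheses (Kcomplex : simplicial_complex K) (fmorse : discrete_morse K f).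
Implicit Types (s t u v w : {set V}) (c : R).

Lemma face_in s t : s \in K -> t \subset s -> t != set0 -> t \in K.
Proof. by case: Kcomplex => _; apply. Qed.

Lemma simplex_neq0 s : s \in K -> s != set0.
Proof. by case: Kcomplex => K0 _; apply: contraTneq => ->. Qed.

Lemma facet_subset t s : facet t s -> t \subset s.
Proof. by case/andP. Qed.

Lemma facet_card t s : facet t s -> #|s| = #|t|.+1.
Proof. by case/andP => _ /eqP. Qed.

Lemma upper_unique t s u : t \in K -> s \in K -> u \in K ->
  facet t s -> facet t u -> f s <= f t -> f u <= f t -> s = u.
Proof.
move=> tK sK uK ts tu fs fu; have [/card_le1_eqP H _] := fmorse tK.
by apply: H; rewrite inE ?sK ?ts ?uK ?tu.
Qed.

Lemma lower_unique s t u : s \in K -> t \in K -> u \in K ->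
  facet t s -> facet u s -> f s <= f t -> f s <= f u -> t = u.
Proof.
move=> sK tK uK ts us ft fu; have [_ /card_le1_eqP H] := fmorse sK.
by apply: H; rewrite inE ?tK ?ts ?uK ?us.
Qed.

(** Going from [t] to [s] adds two vertices, which can be added in either order. *)
Lemma other_facet t u s : facet t u -> facet u s ->
  exists w, [/\ facet t w, facet w s & w != u].
Proof.
move=> /facetP[a ta ->] /facetP[b]; rewrite !inE negb_or => /andP[ba bt] ->.
exists (b |: t); split.
- by apply/facetP; exists b.
- apply/facetP; exists a; last by rewrite setUCA.
  by rewrite !inE negb_or eq_sym ba ta.
apply: contraNneq ba => e; have := setU11 b t.
by rewrite e !inE (negPf bt) orbF.
Qed.

(** As [u] is already a lower exception of [s], the other simplex between [t] and [s] cannot be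
    one. *)
Lemma lower_other_facet t u s : t \in K -> s \in K ->
  facet t u -> facet u s -> f s <= f u ->
  exists w, [/\ w \in K, facet t w, facet w s & f w < f s].
Proof.
move=> tK sK tu us fsu; have [w [tw ws wu]] := other_facet tu us.
have ne v : t \subset v -> v != set0.
  by move=> tv; apply: contraNneq (simplex_neq0 tK) => v0; rewrite -subset0 -v0.
have in_K v : t \subset v -> v \subset s -> v \in K.
  by move=> tv vs; apply: (face_in sK) (ne v tv).
have wK := in_K w (facet_subset tw) (facet_subset ws).
have uK := in_K u (facet_subset tu) (facet_subset us).
exists w; split=> //; rewrite ltNge; apply: contra wu => fw.
by apply/eqP; apply: (lower_unique sK).
Qed.

(** Otherwise the other simplex [w] between [t] and [s] satisfies [f w < f s <= f u <= f t] and is a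
    second upper exception of [t]. So gradient pairs are disjoint: no head is also a tail. *)
Lemma no_lower_and_upper t u s : t \in K -> u \in K -> s \in K ->
  facet t u -> facet u s -> f u <= f t -> f s <= f u -> False.
Proof.
move=> tK uK sK tu us fut fsu.
have [w [wK tw ws fw]] := lower_other_facet tK sK tu us fsu.
have fwu : f w < f u by apply: lt_le_trans fsu.
have e : w = u.
  by apply: (upper_unique tK) => //; apply: le_trans fut; apply: ltW.
by rewrite e ltxx in fwu.
Qed.

(** Descent from [s]: while two vertices of [s] lie outside [t], uniqueness of the lower exception
    of [s] allows one of them to be removed without increasing [f]. *)
Lemma cofacet_below t s : t \in K -> s \in K -> t \proper s ->
  exists u, [/\ u \in K, facet t u & f u <= f s].
Proof.
move=> tK; have [n] := ubnP #|s|; elim: n s => // n IH s; rewrite ltnS => cs sK.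
case/properP=> ts [a as_ at_].
have [e|ne] := eqVneq (#|s|) (#|t|.+1).
  by exists s; rewrite lexx /facet ts e eqxx.
have /properP[_ [b bs bt]] : (a |: t) \proper s.
  rewrite properEcard subUset sub1set as_ ts cardsU1 at_ add1n ltn_neqAle eq_sym ne.
  by apply: proper_card; apply/properP; split=> //; exists a.
have sb x : x \in s -> facet (s :\ x) s.
  by move=> xs; apply/facetP; exists x; rewrite ?setD11 ?setD1K.
have ab : a != b by apply: contraNneq bt => <-; rewrite setU11.
move: bt; rewrite !inE negb_or => /andP[_ bt].
have step x : x \in s -> x \notin t -> f (s :\ x) <= f s ->
    (exists2 y, y \in s & y \notin x |: t) ->
  exists u, [/\ u \in K, facet t u & f u <= f s].
  move=> xs xt fx [y ys yxt].
  have tx : t \proper s :\ x.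
    apply/properP; rewrite subsetD1 ts xt; split=> //; exists y.
      by move: yxt; rewrite !inE negb_or ys => /andP[->].
    by move: yxt; rewrite !inE negb_or => /andP[].
  have xK : s :\ x \in K.
    apply: (face_in sK); first exact: subD1set.
    by apply: contraNneq (simplex_neq0 tK) => e; rewrite -subset0 -e proper_sub.
  have [|u [uK tu fu]] := IH (s :\ x) _ xK tx.
    by move: cs; rewrite (cardsD1 x) xs add1n.
  by exists u; split=> //; apply: le_trans fx.
have [fa|fa] := leP (f (s :\ a)) (f s).
  by apply: (step a) => //; exists b; rewrite // !inE negb_or eq_sym ab.
apply: (step b) => //; last by exists a; rewrite // !inE negb_or ab.
have inK x : x \in s -> x \notin t -> s :\ x \in K.
  move=> xs xt; apply: (face_in sK); first exact: subD1set.
  have : t \subset s :\ x by rewrite subsetD1 ts.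
  by apply: contraTneq => ->; rewrite subset0 simplex_neq0.
rewrite leNgt; apply/negP => fb.
have := lower_unique sK (inK a as_ at_) (inK b bs bt) (sb a as_) (sb b bs)
  (ltW fa) (ltW fb).
by move/setP/(_ b); rewrite !inE eqxx eq_sym ab bs.
Qed.

(* [P] stands for [<= c] or [< c]; by [cofacet_below], adding facets is enough to
   close a sublevel set under faces. *)
Definition entered (P : pred R) : {set {set V}} :=
  [set t in K | P (f t) || [exists u in K, facet t u && P (f u)]].

Lemma enteredP (P : pred R) t :
  reflect (t \in K /\ (P (f t) \/ exists u, [/\ u \in K, facet t u & P (f u)]))
          (t \in entered P).
Proof.
rewrite inE; apply: (iffP andP) => -[tK H]; split=> //.
  case/orP: H => [|/exists_inP[u uK /andP[]]]; first by left.
  by right; exists u.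
case: H => [->//|[u [uK tu Pu]]]; apply/orP; right.
by apply/exists_inP; exists u; rewrite // tu.
Qed.

Lemma sublevelE c : sublevel K f c = entered [pred y | y <= c].
Proof.
apply/setP => t; rewrite !inE; case: (boolP (t \in K)) => //= tK.
apply/exists_inP/orP => [[s sK /andP[fs]]|[ft|/exists_inP[u uK /andP[tu fu]]]].
- rewrite subEproper => /predU1P[->|ts]; first by left.
  right; have [u [uK tu fu]] := cofacet_below tK sK ts.
  by apply/exists_inP; exists u; rewrite // tu /= (le_trans fu).
- by exists t; rewrite // ft /=.
by exists u; rewrite // fu (facet_subset tu).
Qed.

Lemma entered_complex (P : pred R) :
  (forall a b, a <= b -> P b -> P a) -> simplicial_complex (entered P).
Proof.
move=> Pdown; split.
  by rewrite inE; case: Kcomplex => /negPf->.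
move=> s t /enteredP[sK Hs] ts t0.
have tK := face_in sK ts t0; apply/enteredP; split=> //.
have below w : w \in K -> t \proper w -> P (f w) ->
    exists u, [/\ u \in K, facet t u & P (f u)].
  move=> wK tw Pw; have [u [uK tu fu]] := cofacet_below tK wK tw.
  by exists u; split=> //; apply: Pdown Pw.
case: Hs => [Ps|[u [uK su Pu]]].
  move: ts; rewrite subEproper => /predU1P[->|ts]; first by left.
  by right; apply: below Ps.
right; apply: (below u) => //; apply: sub_proper_trans ts _.
by rewrite properEcard (facet_subset su) (facet_card su) /=.
Qed.

End MorseCombinatorics.

(** * The change of homology when the sublevel set crosses one value *)

Section MorseStep.
Variables (R : realType) (F : finFieldType) (V : finType).
Variables (K : {set {set V}}) (f : {set V} -> R) (c : R).
Hypotheses (Kcomplex : simplicial_complex K) (fmorse : discrete_morse K f).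
Implicit Types (s t u v w : {set V}) (x z b : chain F V).

Let L := entered K f [pred y | y <= c].
(** The strict bound describes the preceding stage without naming the preceding value, which does
    not exist for the least one. *)
Let L0 := entered K f [pred y | y < c].

Lemma step_complex : simplicial_complex L.
Proof. by apply: entered_complex => // a b; apply: le_trans. Qed.

Lemma step_complex0 : simplicial_complex L0.
Proof. by apply: entered_complex => // a b; apply: le_lt_trans. Qed.

Lemma new_ge t : t \in K -> t \notin L0 -> c <= f t.
Proof.
by move=> tK; apply: contraNle => ft; apply/enteredP; split=> //; left.
Qed.

Lemma new_cofacet_ge t u :
  t \in K -> u \in K -> facet t u -> t \notin L0 -> c <= f u.
Proof.
move=> tK uK tu; apply: contraNle => fu; apply/enteredP; split=> //.
by right; exists u.
Qed.

(* A tail and a head are the smaller and the larger simplex of a gradient pair. *)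
Variant new_simplex t : Prop :=
| NewCritical of critical K f t & f t = c
| NewTail u of u \in K & facet t u & f u = c & c <= f t
| NewHead v of f t = c & v \in K & facet v t & f t <= f v.

(** A new simplex that enters through a cofacet is a tail, the cofacet having value exactly [c]. One
    that enters by its own value has value [c] and is classified by its exceptions. *)
Lemma newP t : t \in L -> t \notin L0 -> new_simplex t.
Proof.
move=> /enteredP[tK H] tL0; have ct := new_ge tK tL0.
case: H => [/= tc|[u [uK tu /= uc]]]; last first.
  apply: (NewTail uK tu) => //; apply/eqP; rewrite eq_le uc.
  exact: new_cofacet_ge tL0.
have ftc : f t = c by apply/eqP; rewrite eq_le tc.
have [up|[u]] := set_0Vmem (upper_exceptions K f t); last first.
  rewrite inE => /and3P[uK tu fu]; apply: (NewTail uK tu) => //.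
  by apply/eqP; rewrite eq_le -{1}ftc fu; apply: new_cofacet_ge tL0.
have [lo|[v]] := set_0Vmem (lower_exceptions K f t); first exact: NewCritical.
by rewrite inE => /and3P[vK vt fv]; apply: (NewHead ftc vK).
Qed.

Lemma critical_cofacet_lt s u :
  critical K f s -> u \in K -> facet s u -> f s < f u.
Proof.
case=> sK up _ uK su; rewrite ltNge; apply/negP => fu.
by move/setP/(_ u): up; rewrite !inE uK su fu.
Qed.

Lemma critical_facet_lt s v :
  critical K f s -> v \in K -> facet v s -> f v < f s.
Proof.
case=> sK _ lo vK vs; rewrite ltNge; apply/negP => fv.
by move/setP/(_ v): lo; rewrite !inE vK vs fv.
Qed.

Lemma critical_in_step s : critical K f s -> f s = c -> s \in L.
Proof. by case=> sK _ _ fs; apply/enteredP; split; last by left; rewrite /= fs. Qed.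

Lemma critical_new s : critical K f s -> f s = c -> s \notin L0.
Proof.
move=> cs fs; apply/enteredP => -[_ []]; rewrite /= ?fs ?ltxx // => -[u [uK su]].
by rewrite -fs ltNge (ltW (critical_cofacet_lt cs uK su)).
Qed.

Lemma critical_facet_old s v :
  critical K f s -> f s = c -> v \in K -> facet v s -> v \in L0.
Proof.
move=> cs fs vK vs; apply/enteredP; split=> //; left.
by rewrite /= -fs; apply: critical_facet_lt.
Qed.

(** Since [t] is the lower exception of [u], the other simplex between [v] and [u] has value below
    [c] and brings [v] into [L0]. *)
Lemma tail_facet_old v t u : v \in K -> u \in K -> facet v t -> facet t u ->
  f u = c -> c <= f t -> v \in L0.
Proof.
move=> vK uK vt tu fu ft; apply/enteredP; split=> //; right.
rewrite -fu in ft *.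
by have [w [wK vw _ fw]] := lower_other_facet Kcomplex fmorse vK uK vt tu ft; exists w.
Qed.

(** Every cofacet of [s] has value above [c], so [u] could only enter through some [w] with
    [f w <= c < f u]. Then the other simplex between [s] and [w] would be a cofacet of [s] with
    value below [c]. *)
Lemma critical_no_cofacet s u :
  critical K f s -> f s = c -> facet s u -> u \notin L.
Proof.
move=> cs fs su; apply/enteredP => -[uK].
have lt w : w \in K -> facet s w -> c < f w.
  by move=> wK sw; rewrite -fs; apply: critical_cofacet_lt.
have cu := lt u uK su.
case=> [|[w [wK uw]]] /=; first by rewrite leNgt cu.
move=> fw; have sK : s \in K by case: cs.
have fwu : f w <= f u by apply: le_trans (ltW cu).
have [u' [uK' su' _]] := lower_other_facet Kcomplex fmorse sK wK su uw fwu.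
by move/lt_le_trans/(_ fw); rewrite ltNge (ltW (lt _ uK' su')).
Qed.

Lemma boundary_at_critical p b s : critical K f s -> f s = c ->
  b \in chains F p L -> boundary b s = 0.
Proof.
move=> cs fs /chainsP bL; have sK : s \in K by case: cs.
rewrite boundaryE ?(simplex_neq0 Kcomplex) // big1 // => u _.
have [->|/incidence_neq0 su] := eqVneq (incidence F s u) 0; first by rewrite mul0r.
have [->|/bL[]] := eqVneq (b u) 0; first by rewrite mulr0.
by rewrite (negPf (critical_no_cofacet cs fs su)).
Qed.

(* Modulo [L0], the boundary of a new head is plus or minus its tail, and every
   other new simplex is a cycle. *)
Lemma relative_cycle p x :
  x \in chains F p L -> (forall t, boundary x t != 0 -> t \in L0) ->
  (forall s, critical K f s -> f s = c -> x s = 0) ->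
  exists2 b, b \in chains F p.+1 L & x - boundary b \in chains F p L0.
Proof.
move=> xL dx xcrit.
(* Each head receives the coefficient of its tail. Incidences of facets are signs, hence their own
   inverses, so [boundary b] restores [x] at the tails. The sum has at most one term and avoids
   choosing the tail. *)
pose b : chain F V := [ffun s => if (s \in K) && (f s == c) then
  \sum_(v in lower_exceptions K f s) incidence F v s * x v else 0].
have bL : b \in chains F p.+1 L.
  apply/chainsP => s; rewrite ffunE; case: ifP => [/andP[sK /eqP fs]|]; last by rewrite eqxx.
  move=> nz; split; first by apply/enteredP; split=> //; left; rewrite /= fs.
  move/eqP: nz => nz; have [v] : exists v, (v \in lower_exceptions K f s) && (x v != 0).
    apply/existsP; apply: contra_notT nz => /existsPn H; apply: big1 => v vs.
    by have := H v; rewrite vs /= negbK => /eqP->; rewrite mulr0.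
  rewrite inE => /andP[/and3P[_ vs _]]; rewrite (facet_card vs).
  by move/chainsP: xL => xL /xL[_ ->].
exists b => //.
have dL : x - boundary b \in chains F p L.
  by rewrite chainsB // chains_boundary //; apply: step_complex.
have bE t s : t \in K -> t \notin L0 -> s \in K -> facet t s -> f s = c ->
    b s = incidence F t s * x t.
  move=> tK tL0 sK ts fs; have ft : f s <= f t by rewrite fs; apply: new_ge.
  rewrite ffunE sK fs eqxx; apply: big_pred1 => v; rewrite inE.
  apply/and3P/eqP => [[vK vs fv]|->//]; exact: (lower_unique fmorse sK).
have db t s : incidence F t s * b s != 0 -> [/\ s \in K, facet t s & f s = c].
  rewrite mulf_eq0 negb_or => /andP[/incidence_neq0 ts].
  by rewrite ffunE; case: ifP => [/andP[sK /eqP fs] _|]; last by rewrite eqxx.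
apply/chainsP => t nz; have [tL ct] := (chainsP _ _ _ dL) t nz.
split=> //; apply: contraNT nz => tL0; have /enteredP[tK _] := tL.
have t0 := simplex_neq0 Kcomplex tK.
suff e : boundary b t = x t by rewrite ffunE [X in _ + X]ffunE e subrr.
rewrite boundaryE //.
case: (newP tL tL0) => [cs fs|u uK tu fu ft|v ft vK vt ftv].
- rewrite xcrit //; apply: big1 => s _.
  apply/eqP/negPn/negP => /db[sK ts fst].
  by have := critical_cofacet_lt cs sK ts; rewrite fst fs ltxx.
(* At a tail only its head [u] contributes, being the only cofacet whose value does not exceed that
   of the tail. *)
- rewrite (bigD1 u) //= (bE t u) // mulrA incidence_sqr // mul1r.
  rewrite big1 ?addr0 // => s su; apply: contraNeq su => /db[sK ts fs].
  by apply/eqP; apply: (upper_unique fmorse tK); rewrite ?fs ?fu.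
(* At a head both sides vanish: [boundary b] because a head is not a tail, and [x] because the tail
   [v] is new and [t] alone can contribute to the coefficient of [boundary x] at [v], which is zero
   by [dx]. *)
rewrite big1 => [|s _]; last first.
  apply/eqP/negPn/negP => /db[sK ts fs].
  by apply: (no_lower_and_upper Kcomplex fmorse vK tK sK vt ts ftv); rewrite ft fs.
have vL0 : v \notin L0.
  apply/enteredP => -[_ []]; rewrite /= ?ltNge -?ft ?ftv // => -[u [uK vu fu]].
  have e : u = t.
    by apply: (upper_unique fmorse vK) => //; rewrite (le_trans (ltW fu)) // -ft.
  by move: fu; rewrite e ltxx.
have v0 := simplex_neq0 Kcomplex vK.
have := contraNeq (dx v) vL0.
rewrite boundaryE // (bigD1 t) //= big1 ?addr0 => [/eqP|s st].
  rewrite mulf_eq0 => /orP[/eqP i0|/eqP->//].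
  by have /eqP := incidence_sqr F vt; rewrite i0 mul0r eq_sym oner_eq0.
have [->|/incidence_neq0 vs] := eqVneq (incidence F v s) 0; first by rewrite mul0r.
have [->|/((chainsP _ _ _ xL) s)[sL _]] := eqVneq (x s) 0; first by rewrite mulr0.
have [sL0|sL0] := boolP (s \in L0).
  have [_ /(_ s v sL0 (facet_subset vs) v0)] := step_complex0.
  by rewrite (negPf vL0).
case: (newP sL sL0) => [cs fs|u uK su fu fs|w fs wK ws fw].
- by rewrite (critical_facet_old cs fs vK vs) in vL0.
- by rewrite (tail_facet_old vK uK vs su fu fs) in vL0.
have /enteredP[sK _] := sL.
case/eqP: st; apply: (upper_unique fmorse vK) => //; rewrite fs.
exact: new_ge.
Qed.

Lemma criticalP s : reflect (critical K f s)
  [&& s \in K, upper_exceptions K f s == set0 & lower_exceptions K f s == set0].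
Proof. by apply: (iffP and3P) => -[sK /eqP ? /eqP]. Qed.

(** Contrapositive form of [relative_cycle], shared by births, where [x] is a cycle, and deaths,
    where [x] bounds the dying cycle. *)
Lemma critical_in_support p x :
  x \in chains F p L -> (forall t, boundary x t != 0 -> t \in L0) ->
  (forall b, b \in chains F p.+1 L -> x - boundary b \notin chains F p L0) ->
  exists s, [/\ critical K f s, f s = c, #|s| = p.+1 & x s != 0].
Proof.
move=> xL dx xb.
have [/existsP[s /and3P[/criticalP cs /eqP fs xs]]|/existsPn none] :=
  boolP [exists s, [&& [&& s \in K, upper_exceptions K f s == set0
    & lower_exceptions K f s == set0], f s == c & x s != 0]].
  by exists s; split=> //; case: ((chainsP _ _ _ xL) s xs).
case: (relative_cycle xL dx) => [s cs fs|b bL]; last by rewrite (negPf (xb b bL)).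
by have := none s; rewrite fs eqxx (introT (criticalP s) cs) /= negbK => /eqP.
Qed.

(** If [z - boundary b] lay in [L0], it would be an old cycle homologous to [z]. *)
Lemma birth_critical p z : z \in cycles F p L ->
  (forall z0, z0 \in cycles F p L0 -> z - z0 \notin boundaries F p L) ->
  exists s, [/\ critical K f s, f s = c, #|s| = p.+1 & z s != 0].
Proof.
move=> /cyclesP[zL dz] new; apply: critical_in_support => // [t|b bL].
  by rewrite dz ffunE eqxx.
apply/negP => zb; have z0C : z - boundary b \in cycles F p L0.
  by apply/cyclesP; rewrite raddfB /= boundary_boundary dz subrr.
by have := new _ z0C; rewrite subKr imset_f.
Qed.

(** Correcting [b] by a boundary keeps its own boundary; a correction lying in [L0] would make the
    cycle bound there already. *)
Lemma death_critical p b :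
  b \in chains F p.+1 L -> boundary b \in chains F p L0 ->
  boundary b \notin boundaries F p L0 ->
  exists s, [/\ critical K f s, f s = c, #|s| = p.+2 & b s != 0].
Proof.
move=> bL db nb; apply: critical_in_support => // [t /(chainsP _ _ _ db)[]//|b' _].
apply: contra nb => bb'; apply/imsetP; exists (b - boundary b') => //.
by rewrite raddfB /= boundary_boundary subr0.
Qed.

(** Converse of [birth_critical]: neither an old chain nor a boundary from [L] meets the critical
    simplex. *)
Lemma homologous_to_old p z z0 s : critical K f s -> f s = c ->
  z0 \in chains F p L0 -> z - z0 \in boundaries F p L -> z s = 0.
Proof.
move=> cs fs /chainsP z0L /imsetP[b bL e].
rewrite -(subrK z0 z) e ffunE (boundary_at_critical cs fs bL) add0r.
apply/eqP; apply: contraTT isT => /z0L[sL0].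
by rewrite (negPf (critical_new cs fs)) in sL0.
Qed.

End MorseStep.

(** * The indexed filtration in terms of consecutive values *)

Section Filtration.
Variables (R : realType) (V : finType) (K : {set {set V}}) (f : {set V} -> R).
Hypotheses (Kcomplex : simplicial_complex K) (fmorse : discrete_morse K f).
Implicit Types (s t : {set V}).

Let vals := values K f.

Lemma values_lt_sorted : sorted <%R vals.
Proof.
rewrite lt_sorted_uniq_le sort_uniq undup_uniq /=.
exact/sort_le_sorted.
Qed.

Lemma mem_values s : s \in K -> f s \in vals.
Proof. by move=> sK; rewrite mem_sort mem_undup; apply: image_f. Qed.

Lemma value_lt s k : s \in K -> (k < size vals)%N ->
  (f s < nth 0 vals k) = (0 < k)%N && (f s <= nth 0 vals k.-1).
Proof.
move=> /mem_values/(nthP 0)[m ms <-] ks.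
have lt := lt_sorted_ltn_nth 0 values_lt_sorted.
have le := lt_sorted_leq_nth 0 values_lt_sorted.
by case: k ks => [|k] ks; rewrite lt ?inE // ?ltn0 // le ?inE ?(ltnW ks).
Qed.

Lemma filtrationE i : (0 < i <= size vals)%N ->
  filtration K f i = entered K f [pred y | y <= nth 0 vals i.-1] /\
  filtration K f i.-1 = entered K f [pred y | y < nth 0 vals i.-1].
Proof.
case: i => // i /= il; rewrite -sublevelE //; split=> //.
have K0 t : (t \in K) && false = false by rewrite andbF.
case: i il => [|i] il /=; last rewrite sublevelE //.
  (* For the least value the preceding stage is the empty set, and no simplex has a smaller
     value. *)
  apply/esym/setP => t; rewrite !inE; apply/negbTE; rewrite negb_and -implybE.
  apply/implyP => tK; rewrite /= value_lt //=; apply/existsPn => u.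
  by have [uK|//] := boolP (u \in K); rewrite /= value_lt //= andbF.
apply/setP => t; rewrite !inE; case: (boolP (t \in K)) => //= tK.
rewrite value_lt //=; congr (_ || _); apply/eq_existsb => u.
by case: (boolP (u \in K)) => //= uK; rewrite value_lt.
Qed.

Lemma filtration_subset i j :
  (i <= j <= size vals)%N -> filtration K f i \subset filtration K f j.
Proof.
move=> /andP[ij jl]; case: i ij => [|i] ij; first exact: sub0set.
case: j ij jl => // j ij jl; apply/subsetP => t; rewrite !inE => /andP[-> /=].
case/exists_inP=> s sK /andP[fs ts]; apply/exists_inP; exists s => //.
rewrite ts (le_trans fs) // (lt_sorted_leq_nth 0 values_lt_sorted) ?inE //.
exact: leq_ltn_trans jl.
Qed.

Lemma appears s : s \in K -> exists i, appears_at K f s i.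
Proof.
by move=> /mem_values/(nthP 0)[k kl fk]; exists k.+1.
Qed.

Lemma appears_at_unique s i j :
  appears_at K f s i -> appears_at K f s j -> i = j.
Proof.
move=> [i0 il fi] [j0 jl fj]; rewrite -(prednK i0) -(prednK j0); congr _.+1.
apply/eqP; rewrite -(nth_uniq 0 (s := vals)) ?fi ?fj ?prednK //.
exact: lt_sorted_uniq values_lt_sorted.
Qed.

End Filtration.

(** Used to locate deaths and births. For monotone [P] the switch from false to true at [m] is the
    only one. *)
Lemma first_true (P : pred nat) i j : (i <= j)%N -> ~~ P i -> P j ->
  exists m, [/\ (i < m <= j)%N, ~~ P m.-1 & P m].
Proof.
move=> ij Pi; elim: j ij => [|j IH].
  by rewrite leqn0 => /eqP<- /(negP Pi).
rewrite leq_eqVlt => /predU1P[<- /(negP Pi)//|ij Pj].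
have [/(IH ij)[m [/andP[im mj] nP Pm]]|nPj] := boolP (P j); last first.
  by exists j.+1; rewrite ij leqnn.
by exists m; rewrite im ltnW.
Qed.

(** * Births and deaths of classes at critical simplices *)

Section PersistentClasses.
Variables (R : realType) (F : finFieldType) (V : finType).
Variables (K : {set {set V}}) (f : {set V} -> R).
Implicit Types (s t : {set V}) (z : chain F V).

Let n := size (values K f).
Let G := filtration K f.

(** Membership in an image of homology, stated on a representative so that later arguments handle
    chains instead of cosets. *)
Definition comes_from p i j z :=
  [exists z0 in cycles F p (G i), z - z0 \in boundaries F p (G j)].

Lemma image_homologyP p i j z : (i <= j <= n)%N ->
  (hclass p (G j) z \in image_homology F K f p i j) = comes_from p i j z.
Proof.
move=> ij; apply/imsetP/exists_inP => [[_ /imsetP[z0 z0L ->] /eqP]|[z0 z0L zz0]].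
  by rewrite induced_hclass ?filtration_subset // hclass_eq; exists z0.
exists (hclass p (G i) z0); first exact: imset_f.
by apply/eqP; rewrite induced_hclass ?filtration_subset // hclass_eq.
Qed.

Lemma born_atP p i (h : {set chain F V}) : (i <= n)%N ->
  born_at K f p i h <->
  exists z,
    [/\ z \in cycles F p (G i), h = hclass p (G i) z & ~~ comes_from p i.-1 i z].
Proof.
move=> il; split=> [[/imsetP[z zL ->] ni]|[z [zL -> nf]]].
  by exists z; rewrite -image_homologyP // leq_pred.
by split; [apply: imset_f | rewrite image_homologyP ?leq_pred].
Qed.

Lemma dies_atP p i j z : (j <= n)%N ->
  dies_at K f p i j (hclass p (G i) z) <->
  [/\ (i < j)%N, ~~ comes_from p i.-1 j.-1 z & comes_from p i.-1 j z].
Proof.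
move=> jl; have H : (i < j)%N ->
    induced p (G j.-1) (hclass p (G i) z) = hclass p (G j.-1) z /\
    induced p (G j) (hclass p (G i) z) = hclass p (G j) z /\
    (i.-1 <= j.-1 <= n)%N /\ (i.-1 <= j <= n)%N.
  move=> ij; have ij1 : (i <= j.-1)%N by rewrite -ltnS (ltn_predK ij).
  have j1l : (j.-1 <= n)%N by rewrite (leq_trans (leq_pred _)).
  have i1 := leq_pred i.
  rewrite !induced_hclass ?filtration_subset ?ij1 ?(ltnW ij) //.
  by rewrite j1l jl !(leq_trans i1) // ltnW.
split=> -[ij]; have [e1 [e2 [l1 l2]]] := H ij.
  by rewrite e1 e2 !image_homologyP.
by split=> //; rewrite ?e1 ?e2 image_homologyP.
Qed.

Lemma comes_from_boundaries p i j k z :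
  (j <= k <= n)%N -> comes_from p i j z -> comes_from p i k z.
Proof.
move=> jk /exists_inP[z0 z0L zz0]; apply/exists_inP; exists z0 => //.
by apply: boundaries_subset zz0; apply: filtration_subset.
Qed.

Lemma comes_from_sub_scale p i j k y z : comes_from p i j y -> comes_from p i j z ->
  comes_from p i j (y - scale_chain k z).
Proof.
move=> /exists_inP[y0 y0L yy0] /exists_inP[z0 z0L zz0].
apply/exists_inP; exists (y0 - scale_chain k z0); first exact: cycles_sub_scale.
have -> : y - scale_chain k z - (y0 - scale_chain k z0) =
          (y - y0) - scale_chain k (z - z0).
  rewrite scale_chainB !opprB [scale_chain k z0 - y0]addrC addrACA.
  by rewrite [- scale_chain k z + _]addrC.
exact: boundaries_sub_scale.
Qed.

Hypotheses (Kcomplex : simplicial_complex K) (fmorse : discrete_morse K f).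
Hypothesis fexcellent : excellent K f.

Lemma born_critical p i z : (0 < i <= n)%N ->
  z \in cycles F p (G i) -> ~~ comes_from p i.-1 i z ->
  exists s,
    [/\ critical K f s, f s = nth 0 (values K f) i.-1, #|s| = p.+1 & z s != 0].
Proof.
rewrite /comes_from /G => /(filtrationE Kcomplex fmorse)[-> ->] zL nf.
apply: (birth_critical Kcomplex fmorse zL) => z0 z0L.
by apply: contra nf => zz0; apply/exists_inP; exists z0.
Qed.

Lemma comes_from_critical p i z s : (0 < i <= n)%N ->
  critical K f s -> f s = nth 0 (values K f) i.-1 ->
  comes_from p i.-1 i z -> z s = 0.
Proof.
rewrite /comes_from /G => /(filtrationE Kcomplex fmorse)[-> ->] cs fs.
case/exists_inP => z0 /cyclesP[z0L _].
exact: (homologous_to_old Kcomplex fmorse cs fs z0L).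
Qed.

(* [b] witnesses that the class of its boundary dies at [c_i]. *)
Definition kills p i b := [/\ b \in chains F p.+1 (G i),
  boundary b \in chains F p (G i.-1) & boundary b \notin boundaries F p (G i.-1)].

Lemma kills_critical p i b : (0 < i <= n)%N -> kills p i b ->
  exists s,
    [/\ critical K f s, f s = nth 0 (values K f) i.-1, #|s| = p.+2 & b s != 0].
Proof.
rewrite /kills /G => /(filtrationE Kcomplex fmorse)[-> ->] [bL db nb].
exact: (death_critical Kcomplex fmorse bL db nb).
Qed.

(** The chain [b] bounds the difference between [z] and the older cycle with which it merges. *)
Lemma death_kills p i j z : (0 < j <= n)%N -> (i <= j.-1)%N ->
  z \in cycles F p (G j.-1) -> ~~ comes_from p i j.-1 z -> comes_from p i j z ->
  exists b, kills p j b.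
Proof.
move=> jn ij /cyclesP[zL dz] nf /exists_inP[z0 z0L /imsetP[b bL e]].
have [j0 jl] := andP jn; have j1l : (j.-1 <= n)%N by rewrite (leq_trans (leq_pred _)).
have [z0C _] := cyclesP _ _ _ z0L.
exists b; split=> //; rewrite -e.
  by rewrite chainsB // (chains_subset _ z0C) // filtration_subset // ij.
by apply: contra nf => zz0; apply/exists_inP; exists z0.
Qed.

(** Excellence makes [s] the only critical simplex at this value, so the killing chain must contain
    it. Subtracting a multiple of [z] removes [s] but keeps the boundary, leaving a killing chain
    without a critical simplex. *)
Lemma cycle_not_kills p p' i z b s : (0 < i <= n)%N ->
  critical K f s -> f s = nth 0 (values K f) i.-1 ->
  z \in cycles F p (G i) -> z s != 0 -> ~ kills p' i b.
Proof.
move=> il cs fs zL zs kb; have [s' [cs' fs' card_s' bs']] := kills_critical il kb.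
have [zC dz] := cyclesP _ _ _ zL; have [_ card_s] := (chainsP _ _ _ zC) _ zs.
have e : s' = s by apply: fexcellent; rewrite // fs.
subst s'; have pp : p = p'.+1 by move: card_s'; rewrite card_s => -[].
subst p; have [bL db nb] := kb.
have dbz : boundary (b - scale_chain (b s / z s) z) = boundary b.
  rewrite raddfB /= boundary_scale dz.
  by apply/ffunP => t; rewrite !ffunE mulr0 subr0.
have [|s' [cs'' fs'' _]] := @kills_critical p' i (b - scale_chain (b s / z s) z) il.
  by split; rewrite ?dbz // chains_sub_scale.
have -> : s' = s by apply: fexcellent; rewrite // fs.
by rewrite !ffunE divfK // subrr eqxx.
Qed.

Lemma critical_eq s t i : critical K f s -> critical K f t ->
  appears_at K f s i -> f t = nth 0 (values K f) i.-1 -> t = s.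
Proof. by move=> cs ct [_ _ fs] ft; apply: fexcellent; rewrite // ft. Qed.

Lemma appears_at_range s i : appears_at K f s i -> (0 < i <= n)%N.
Proof. by case=> -> ->. Qed.

Lemma born_at_critical s i p h : critical K f s -> appears_at K f s i ->
  born_at K f p i h ->
  #|s| = p.+1 /\
  exists z, [/\ z \in cycles F p (G i), h = hclass p (G i) z,
    ~~ comes_from p i.-1 i z & z s != 0].
Proof.
move=> cs si; have il := appears_at_range si.
case/born_atP=> [|z [zL -> nf]]; first by case/andP: il.
have [t [ct ft card_t zt]] := born_critical il zL nf.
by rewrite (critical_eq cs ct si ft) in card_t zt; split=> //; exists z.
Qed.

Lemma critical_birth s q i z : critical K f s -> appears_at K f s i ->
  z \in cycles F q (G i) -> z s != 0 ->
  (exists tau : {set V}, simplex_dim tau = q.+1 /\ persistence_pair F K f s tau) \/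
  persistence_pair_infty F K f s.
Proof.
move=> cs si zL zs; have il := appears_at_range si.
have sK : s \in K by case: cs.
have nf : ~~ comes_from q i.-1 i z.
  by apply: contra zs => /comes_from_critical -> //; case: si.
have bz : born_at K f q i (hclass q (G i) z).
  by apply/born_atP; [case/andP: il | exists z].
have [/existsP[[j jn] /= /andP[ij fj]]|/existsPn none] :=
  boolP [exists j : 'I_n.+1, (i <= j)%N && comes_from q i.-1 j z]; last first.
  right; split=> //; exists q, i, (hclass q (G i) z); split=> // j jn.
  case/dies_atP=> // ij _ fj; have := none (Ordinal (jn : (j < n.+1)%N)).
  by rewrite /= fj ltnW.
(* The death occurs at the stage [m] where [z] becomes homologous to a cycle older than its
   birth. *)
left; have [m [/andP[im mj] nfm fm]] :=
  first_true (P := fun k => comes_from q i.-1 k z) ij nf fj.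
have mn : (0 < m <= n)%N by rewrite (leq_ltn_trans _ im) // (leq_trans mj).
have im1 : (i <= m.-1)%N by rewrite -ltnS (ltn_predK im).
have zLm : z \in cycles F q (G m.-1).
  have [zC dz] := cyclesP _ _ _ zL; apply/cyclesP; split=> //.
  apply: chains_subset zC; apply: filtration_subset; rewrite im1.
  by rewrite (leq_trans (leq_pred _)) //; case/andP: mn.
have [|b kb] := @death_kills q i.-1 m z mn _ zLm nfm fm.
  by rewrite (leq_trans (leq_pred _)).
have [t [ct ft card_t _]] := kills_critical mn kb.
exists t; split; first by rewrite /simplex_dim card_t.
split=> //; split; first by case: ct.
exists q, i, m, (hclass q (G i) z); split=> //; first by case/andP: mn.
by apply/dies_atP; first by case/andP: mn.
Qed.

(** The class that dies is traced back, within the stage before [s], to the earliest stage [m]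
    holding a representative [z0]; the critical simplex of stage [m] is [alpha]. *)
Lemma critical_death s q i z : critical K f s -> appears_at K f s i ->
  #|s| = q.+2 -> z \in cycles F q (G i.-1) ->
  z \in boundaries F q (G i) -> z \notin boundaries F q (G i.-1) ->
  exists alpha : {set V}, #|alpha| = q.+1 /\ persistence_pair F K f alpha s.
Proof.
move=> cs si card_s zL zb nzb; have /andP[i0 il] := appears_at_range si.
(* Stage 0 is empty, so its only cycle is 0, and [z] does not bound before [s] enters. *)
have n0 : ~~ comes_from q 0 i.-1 z.
  apply/exists_inP => -[z0 /cyclesP[z0L _]].
  have -> : z0 = 0.
    apply/ffunP => t; rewrite ffunE; apply/eqP; apply: contraT.
    by move=> /(chainsP _ _ _ z0L)[]; rewrite inE.
  by rewrite subr0 (negPf nzb).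
have fi : comes_from q i.-1 i.-1 z.
  by apply/exists_inP; exists z; rewrite // subrr boundaries0.
have [m [/andP[m0 mi] nfm /exists_inP[z0 z0L zz0]]] :=
  first_true (P := fun k => comes_from q k i.-1 z) (leq0n _) n0 fi.
have mi' : (m < i)%N by rewrite -(prednK i0).
have mn : (0 < m <= n)%N by rewrite m0 (leq_trans (ltnW mi')).
have nf : ~~ comes_from q m.-1 i.-1 z0.
  apply: contra nfm => /exists_inP[z1 z1L z01]; apply/exists_inP; exists z1 => //.
  by rewrite -(subrKA z0) boundariesD.
have nfm' : ~~ comes_from q m.-1 m z0.
  apply: contra nf; apply: comes_from_boundaries; rewrite mi.
  by rewrite (leq_trans (leq_pred _)).
have [t [ct ft card_t _]] := born_critical mn z0L nfm'.
exists t; split=> //; split; first by case: ct.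
split; first by case: cs.
exists q, m, i, (hclass q (G m) z0); split=> //; first by case/andP: mn.
  by apply/born_atP; [case/andP: mn | exists z0].
(* At stage [i] the cycle [z0] bounds together with [z], so it merges with the class of 0, which is
   old at every stage. *)
apply/dies_atP => //; split=> //; apply/exists_inP; exists 0.
  by apply/cyclesP; rewrite chains0 raddf0.
rewrite subr0 -[z0](subKr z) boundariesB //.
by apply: boundaries_subset zz0; apply: filtration_subset; rewrite leq_pred.
Qed.

End PersistentClasses.

(** * Mutual exclusion and existence of the three kinds of pairs *)

Theorem theorem3p6 (R : realType) (F : finFieldType) (V : finType)
    (K : {set {set V}}) (f : {set V} -> R) (q : nat) (sigma : {set V}) :
  simplicial_complex K ->
  discrete_morse K f ->
  excellent K f ->
  critical K f sigma ->
  simplex_dim sigma = q ->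
  exactly_one_of_three
    (exists tau : {set V},
       simplex_dim tau = q.+1 /\ persistence_pair F K f sigma tau)
    (exists alpha : {set V},
       (simplex_dim alpha).+1 = q /\ persistence_pair F K f alpha sigma)
    (persistence_pair_infty F K f sigma).
Proof.
move=> Kcomplex fmorse fexcellent cs dim_s.
have sK : sigma \in K by case: cs.
have card_s : #|sigma| = q.+1.
  by rewrite -dim_s /simplex_dim prednK // card_gt0 (simplex_neq0 Kcomplex).
have [i si] := appears f sK; have il := appears_at_range si.
have fs : f sigma = nth 0 (values K f) i.-1 by case: si.
have births1 tau : persistence_pair F K f sigma tau -> exists j z,
    [/\ (j <= size (values K f))%N, z \in cycles F q (filtration K f i),
        z sigma != 0
      & [/\ (i < j)%N & comes_from K f q i.-1 j z]].
  case=> _ [_ [p [i' [j [h [si' tj bh dh]]]]]].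
  move: bh dh; rewrite (appears_at_unique si' si) => bh dh.
  have [card_p [z [zL e nf zs]]] := born_at_critical Kcomplex fmorse fexcellent cs si bh.
  have jn : (j <= size (values K f))%N by case: tj.
  move: dh; rewrite e => /dies_atP-/(_ jn)[ij _ fj].
  have pq : p = q by move: card_p; rewrite card_s => -[].
  by subst p; exists j, z.
have births3 : persistence_pair_infty F K f sigma -> exists z,
    [/\ z \in cycles F q (filtration K f i), z sigma != 0,
      ~~ comes_from K f q i.-1 i z
      & forall j, (j <= size (values K f))%N ->
          ~ dies_at K f q i j (hclass q (filtration K f i) z)].
  case=> _ [p [i' [h [si' bh dh]]]].
  move: bh dh; rewrite (appears_at_unique si' si) => bh dh.
  have [card_p [z [zL e nf zs]]] := born_at_critical Kcomplex fmorse fexcellent cs si bh.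
  have pq : p = q by move: card_p; rewrite card_s => -[].
  by subst p; exists z; split=> //; rewrite -e.
have deaths alpha : persistence_pair F K f alpha sigma ->
    exists p b, @kills R F V K f p i b.
  case=> _ [_ [p [i' [j [h [ai sj bh dh]]]]]].
  move: dh; rewrite (appears_at_unique sj si) => dh.
  have [_ il'] := andP il.
  have i'l : (i' <= size (values K f))%N by case: ai.
  have [z [zL e _]] := (born_atP _ _ i'l).1 bh.
  move: dh; rewrite e => /dies_atP-/(_ il')[ij nf fj].
  have ij1 : (i' <= i.-1)%N by rewrite -ltnS (ltn_predK ij).
  exists p; apply: (death_kills il _ _ nf fj).
    by rewrite (leq_trans (leq_pred _)).
  have [zC dz] := cyclesP _ _ _ zL; apply/cyclesP; split=> //.
  by apply: chains_subset zC; apply: filtration_subset; rewrite ij1 (leq_trans (leq_pred _)).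
split; last first.
- split.
  + move=> [[tau [_ /births1[j [z [_ zL zs _]]]]] [alpha [_ /deaths[p [b kb]]]]].
    exact: (cycle_not_kills Kcomplex fmorse fexcellent il cs fs zL zs kb).
  + move=> [[tau [_ /births1[j [z [jn zL zs [ij fj]]]]]] /births3[z' [zL' zs' nf' never]]].
    (* The scalar cancels [sigma] in [y], so [y] is homologous to an older cycle. As [z] merges with
       older classes by stage [j], so does [z'], a combination of [y] and [z], against its never
       dying. *)
    pose k := z' sigma / z sigma; pose y := z' - scale_chain k z.
    have yL : y \in cycles F q (filtration K f i) by apply: cycles_sub_scale.
    have fy : comes_from K f q i.-1 i y.
      apply: contraT => /(born_critical Kcomplex fmorse il yL)[t [ct ft _]].
      rewrite (critical_eq fexcellent cs ct si ft) !ffunE divfK //.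
      by rewrite subrr eqxx.
    have fyj : comes_from K f q i.-1 j y by apply: comes_from_boundaries fy; rewrite ltnW.
    have fj' : comes_from K f q i.-1 j z'.
      have -> : z' = y - scale_chain (- k) z.
        by apply/ffunP => t; rewrite !ffunE mulNr opprK subrK.
      exact: comes_from_sub_scale.
    have [m [/andP[im mj] nfm fm]] :=
      first_true (P := fun j => comes_from K f q i.-1 j z') (ltnW ij) nf' fj'.
    have mn : (m <= size (values K f))%N by apply: leq_trans jn.
    by apply: (never m mn); apply/dies_atP.
  move=> [[alpha [_ /deaths[p [b kb]]]] /births3[z [zL zs _ _]]].
  exact: (cycle_not_kills Kcomplex fmorse fexcellent il cs fs zL zs kb).
(* A cycle through [sigma] gives a birth, hence a pair of the first or third kind; otherwise the
   boundary of [sigma] dies. *)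
have [/exists_inP[z zL zs]|/exists_inPn none] :=
  boolP [exists z in cycles F q (filtration K f i), z sigma != 0].
  have [H|H] := critical_birth Kcomplex fmorse cs si zL zs.
    exact: Or31.
  exact: Or33.
apply: Or32.
pose x : chain F V := [ffun s => (s == sigma)%:R].
have xs : x sigma = 1 by rewrite ffunE eqxx.
have sL : sigma \in filtration K f i.
  by rewrite (filtrationE Kcomplex fmorse il).1; apply: critical_in_step.
have xL : x \in chains F q (filtration K f i).
  apply/chainsP => s; rewrite ffunE; case: (eqVneq s sigma) => [->|]; last by rewrite eqxx.
  by [].
(* If [b] avoided [sigma] and had the same boundary as [x], then [x - b] would be a cycle through
   [sigma]. *)
have nc b : b \in chains F q (filtration K f i) -> b sigma = 0 -> boundary x != boundary b.
  move=> bL bs; apply/eqP => e; have /none/negP[] : x - b \in cycles F q (filtration K f i).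
    by apply/cyclesP; rewrite chainsB // raddfB /= e subrr.
  by rewrite ffunE [X in _ + X]ffunE xs bs subr0 oner_eq0.
have old b : b \in chains F q (filtration K f i.-1) -> boundary x != boundary b.
  move=> bL; apply: nc.
    apply: chains_subset bL; apply: filtration_subset; rewrite leq_pred.
    by case/andP: il.
  apply/eqP; apply: contraT => /(chainsP _ _ _ bL)[].
  by rewrite (filtrationE Kcomplex fmorse il).2 (negPf (critical_new cs fs)).
(* A vertex has zero boundary, which already bounds the zero chain, so [old] excludes dimension
   0. *)
case: q => [|q] in dim_s card_s births1 births3 none xL nc old *.
  have := old 0; rewrite chains0 raddf0 => /(_ isT)/eqP[].
  apply/ffunP => t; rewrite [RHS]ffunE; apply/eqP.
  apply: contraT => /boundary_support[t0 [s ts /(chainsP _ _ _ xL)[_]]].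
  by rewrite (facet_card ts) => -[ct]; rewrite -card_gt0 ct in t0.
have [|||alpha [card_a pa]] := @critical_death R F V K f Kcomplex fmorse
  sigma q i (boundary x) cs si card_s.
- apply/cyclesP; split; last exact: boundary_boundary.
  apply/chainsP => t /boundary_support[t0 [s ts xs0]].
  have [_ card_t] := chainsP _ _ _ xL _ xs0.
  have es : s = sigma by move: xs0; rewrite ffunE; case: (eqVneq s) => //; rewrite eqxx.
  split; last by move: card_t; rewrite (facet_card ts) => -[].
  rewrite es in ts; rewrite (filtrationE Kcomplex fmorse il).2.
  apply: (critical_facet_old cs fs _ ts).
  exact: (face_in Kcomplex sK (facet_subset ts)).
- exact: imset_f.
- by apply/imsetP => -[b bL e]; have := old b bL; rewrite e eqxx.
by exists alpha; rewrite /simplex_dim card_a.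
Qed.
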